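(* Let $A$ be a finite alphabet and let $X \subseteq A^{\mathbb{Z}}$ be a subshift. Then $X$ has positive topological entropy if and only if there exists $x \in A^{-\mathbb{N}}$ such that the set $\{y \in A^{\mathbb{N}} : x \cdot y \in X\}$ contains a steadily branching binary tree.
   Context: $\mathbb{N}$ contains $0$. An alphabet is a finite set $A$, and $A^{\mathbb{Z}}$ carries the product topology ($A$ discrete). A subshift of $A^{\mathbb{Z}}$ is a closed set $X \subseteq A^{\mathbb{Z}}$ with $\sigma(X) \subseteq X$, where $\sigma(x)_i = x_{i+1}$. The words of $X$ are the finite words $w \in A^*$ such that $x|_{[0,|w|-1]} = w$ for some $x \in X$; $L_n$ denotes the set of words of $X$ of length $n$. The topological entropy is $h(X) = \lim_{n\to\infty} \frac{\log |L_n|}{n}$. Elements of $A^{-\mathbb{N}}$ are left-infinite sequences over $A$. For $x \in A^{-\mathbb{N}}$ and $y \in A^{\mathbb{N}}$, $x \cdot y \in A^{\mathbb{Z}}$ denotes the configuration with $x$ and $y$ placed back to back: $y$ occupies the coordinates $0,1,2,\dots$ and $x$ occupies the coordinates $\dots,-2,-1$ (the last symbol of $x$ being at coordinate $-1$). For $z, b \in \mathbb{N}^{\mathbb{N}}$ write $z \leq b$ if $z_i \leq b_i$ for all $i$. For a set $S \subseteq A^{\mathbb{N}}$ and $b \in \mathbb{N}^{\mathbb{N}}$, a tree in $S$ with branching structure $b$ is a family $(x^z)_{z \in \mathbb{N}^{\mathbb{N}},\, z \leq b}$ with each $x^z \in S$ such that for all $z, z' \leq b$ and all $i \in \mathbb{N}$,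 $$x^z_{[0,i)} = x^{z'}_{[0,i)} \iff z_{[0,i)} = z'_{[0,i)}.$$ A steadily branching binary tree in $S$ is a tree in $S$ with a branching structure $b \in \{0,1\}^{\mathbb{N}}$ satisfying $\liminf_{i\to\infty} \frac{1}{i}\sum_{j=0}^{i-1} b_j > 0$; $S$ contains such a tree if one exists in $S$. *)

(* Defs.v *)
From mathcomp Require Import all_boot all_order all_algebra.
From mathcomp Require Import all_classical all_reals all_analysis.

Set Implicit Arguments.
Unset Strict Implicit.
Unset Printing Implicit Defensive.

Import Order.TTheory GRing.Theory Num.Theory.
Import numFieldNormedType.Exports.

Local Open Scope classical_set_scope.
Local Open Scope ring_scope.

Notation configuration A := {ptws int -> discrete_topology A}.

Definition sigma (A : finType) (x : configuration A) : configuration A :=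
  fun i => x (i + 1).

(* Only forward invariance is required. *)
Definition subshift (A : finType) (X : set (configuration A)) : Prop :=
  closed X /\ @sigma A @` X `<=` X.

Definition words (A : finType) (X : set (configuration A)) : set (seq A) :=
  [set w | exists2 x, X x & mkseq (fun k => x k%:Z : A) (size w) = w].

Definition words_of_length (A : finType) (X : set (configuration A)) (n : nat)
  : {set n.-tuple A} :=
  [set w : n.-tuple A | `[< words X w >]]%SET.

(* For a subshift the limit exists: #|L_n| is submultiplicative in n.  If X is
   empty, then ln 0 = 0 gives the value 0, which is not positive. *)
Definition entropy (R : realType) (A : finType) (X : set (configuration A))
  : R :=
  limn (fun n : nat => ln (#|words_of_length X n|%:R : R) / n%:R).

(* A left-infinite sequence x is represented by a function on nat, read from
   right to left: x k is the symbol at index -k.  Hence x k is placed at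
   coordinate -(k+1) = Negz k of the configuration. *)
Definition concat (A : finType) (x y : nat -> A) : configuration A :=
  fun i => match i with Posz k => y k | Negz k => x k end.

Definition agree_below (T : Type) (i : nat) (u v : nat -> T) : Prop :=
  forall j, (j < i)%N -> u j = v j.

Definition seq_le (z b : nat -> nat) : Prop := forall i, (z i <= b i)%N.

(* The family (x^z) is indexed by all z, but only its members with z <= b are
   constrained. *)
Definition tree_in (A : finType) (S : set (nat -> A)) (b : nat -> nat)
    (x : (nat -> nat) -> nat -> A) : Prop :=
  (forall z, seq_le z b -> S (x z)) /\
  (forall z z', seq_le z b -> seq_le z' b ->
    forall i, agree_below i (x z) (x z') <-> agree_below i z z').

(* The averages are bounded since b takes values in {0, 1}, so the real-valued
   limn_inf is the actual limit inferior. *)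
Definition steadily_branching (R : realType) (b : nat -> nat) : Prop :=
  (forall i, (b i <= 1)%N) /\
  0 < limn_inf (fun i : nat => (\sum_(0 <= j < i) (b j)%:R) / i%:R : R).

Definition contains_steadily_branching_binary_tree (R : realType) (A : finType)
    (S : set (nat -> A)) : Prop :=
  exists (b : nat -> nat) (x : (nat -> nat) -> nat -> A),
    steadily_branching R b /\ tree_in S b x.

(* Main.v *)
Require Import Defs.
From mathcomp Require Import all_boot all_order all_algebra.
From mathcomp Require Import all_classical all_reals all_analysis.
From mathcomp Require Import zify ring lra.

(** Write L_n for the set of words of length n of the subshift X.

    A steadily branching tree over a fixed past forces entropy: along a
    branching structure b, the tree has 2 ^ (b_0 + ... + b_(n-1)) distinct
    prefixes of length n, all of them in L_n ([card_prefixes]).  A lower bound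
    e > 0 on the averages of b gives h(X) >= e ln 2.  The limit defining the
    entropy exists by subadditivity ([fekete]).

    Conversely, three ideas turn positive entropy into a tree.

    - Many words contain a bushy tree.  A weighted, ordered form of the
      Sauer-Shelah lemma holds: a set of words of length n over k letters has
      at most the sum of k ^ |b| elements, where b ranges over the binary
      branching structures of length n that have a tree in the set and |b| is
      the number of ones of b ([card_le_sum_trees]).  The structures with
      |b| <= n / D contribute at most exp (c n), where c tends to 0 as D
      grows ([card_le_sparse_trees]), so an exponentially large L_n contains a
      tree with |b| >= n / D for a constant D ([has_long_tree]).

    - A bushy tree has steady subtrees.  If b has density 1 / D, then far from
      both ends of b there is a position from which all the averages of b over
      up to N terms are at least 1 / (2 D): otherwise b could be cut greedily
      into blocks of smaller density ([steady_window]).  Choosing one branch up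
      to that position gives a common past, of length at least N, for a tree of
      height N whose partial averages are all bounded below ([approximants]).

    - Compactness.  Since a prefix of a branch depends only on a prefix of its
      index z, a tree is the same as a labelling f of finite sequences, the
      branch of index z reading f (z_0), f (z_0 z_1), f (z_0 z_1 z_2), ...
      Past, branching structure and labelling are thus points of products of
      finite sets, and their limit along an ultrafilter on the heights N is an
      infinite tree over an infinite past ([exists_tree_coding]).  Its branches
      lie in X because X is closed. *)

Set Implicit Arguments.
Unset Strict Implicit.
Unset Printing Implicit Defensive.

Import Order.TTheory GRing.Theory Num.Theory.
Import numFieldNormedType.Exports.

Local Open Scope classical_set_scope.
Local Open Scope ring_scope.

(** * Finite trees of words *)

(** A branching structure is encoded as a sequence of booleans, the letters
    [a0] and [a1] labelling the two children of the root.  At a level without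
    branching [a0] and [a1] are allowed to coincide, so that both cases have
    the same form; there, either one of them alone gives the tree. *)
Fixpoint has_tree (A : finType) (P : seq A -> Prop) (b : seq bool) : Prop :=
  if b is c :: b' then
    exists a0 a1 : A, [/\ c -> a0 != a1,
      has_tree (fun w => P (a0 :: w)) b' & has_tree (fun w => P (a1 :: w)) b']
  else P [::].

Lemma big_tuple_cons (T : finType) (n : nat) (F : n.+1.-tuple T -> nat) :
  (\sum_(w : n.+1.-tuple T) F w
   = \sum_(a : T) \sum_(w : n.-tuple T) F [tuple of a :: w])%N.
Proof.
rewrite pair_big /=.
rewrite (reindex (fun p : T * n.-tuple T => [tuple of p.1 :: p.2])) //=.
exists (fun w : n.+1.-tuple T => (thead w, [tuple of behead w])).
- by move=> [a w] _ /=; congr pair; apply: val_inj.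
- by move=> w _; rewrite /= [RHS]tuple_eta.
Qed.

Lemma card_set_asbool (T : finType) (Q : T -> Prop) :
  #|[set w : T | `[< Q w >]]%SET| = (\sum_(w : T) `[< Q w >])%N.
Proof.
rewrite -sum1_card [RHS](bigID (fun w => `[< Q w >])) /=.
rewrite [X in (_ + X)%N]big1 ?addn0.
  by apply: eq_big => [w|w]; rewrite inE // => ->.
by move=> w /negbTE ->.
Qed.

Lemma sum_tuple0 (T : finType) (F : 0.-tuple T -> nat) :
  (\sum_(w : 0.-tuple T) F w = F [tuple])%N.
Proof. by rewrite (big_pred1 [tuple]) // => t; exact/esym/eqP/tuple0. Qed.

(** The Sauer-Shelah induction on the first letter.  If a structure [b] has a
    tree in exactly m of the sets of words that follow the various first
    letters, then it accounts for m copies of its weight in the induction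
    hypotheses.  For m >= 1 the structure 0b has a tree in [P], and for m >= 2
    so does 1b, whose weight carries an additional factor #|A| >= m. *)
Lemma card_le_sum_trees (A : finType) (n : nat) (P : seq A -> Prop) :
  (#|[set w : n.-tuple A | `[< P w >]]%SET|
   <= \sum_(b : n.-tuple bool) `[< has_tree P b >] * #|A| ^ count id b)%N.
Proof.
rewrite card_set_asbool; elim: n P => [|n IH] P.
  by rewrite !sum_tuple0 /= expn0 muln1.
rewrite !big_tuple_cons big_bool /=.
apply: (@leq_trans (\sum_(a : A) \sum_(b : n.-tuple bool)
    `[< has_tree (fun w => P (a :: w)) b >] * #|A| ^ count id b)).
  by apply: leq_sum => a _; exact: IH.
rewrite exchange_big -big_split; apply: leq_sum => b _ /=.
rewrite -big_distrl /= add0n add1n expnS mulnA -mulnDl leq_mul2r.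
apply/orP; right.
set Q := fun a : A => has_tree (fun w => P (a :: w)) b.
rewrite -(card_set_asbool Q).
set S := [set a | _]%SET.
have le_A : (#|S| <= #|A|)%N by exact: max_card.
have inS a : a \in S -> Q a by rewrite inE => /asboolP.
have [/card_gt1P[a0 [a1 [/inS Q0 /inS Q1 a01]]]|] := ltnP 1 #|S|.
  rewrite (asboolT (P := exists _, _)); last by exists a0, a1.
  by rewrite mul1n; apply: leq_trans le_A _; exact: leq_addr.
case: (set_0Vmem S) => [-> |[a /inS Qa] S1]; first by rewrite cards0.
rewrite addnC (asboolT (P := exists _, _)); last by exists a, a.
exact: leq_trans S1 (leq_addr _ _).
Qed.

(** Following one branch through the first levels leads to a subtree. *)
Lemma has_tree_cat (A : finType) (b c : seq bool) (P : seq A -> Prop) :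
  has_tree P (b ++ c) ->
  exists2 u, size u = size b & has_tree (fun w => P (u ++ w)) c.
Proof.
elim: b P => [|e b IH] P /=; first by exists [::].
by move=> [a [_ [_ /IH[u <- ?] _]]]; exists (a :: u).
Qed.

Lemma has_tree_mono (A : finType) (b : seq bool) (P Q : seq A -> Prop) :
  (forall w, P w -> Q w) -> has_tree P b -> has_tree Q b.
Proof.
elim: b P Q => [|e b IH] P Q PQ /=; first exact: PQ.
by move=> [a0 [a1 [a01 h0 h1]]]; exists a0, a1; split => //;
  [apply: IH h0|apply: IH h1] => w; exact: PQ.
Qed.

Lemma has_tree_take (A : finType) (b c : seq bool) (P : seq A -> Prop) :
  (forall v w, P (v ++ w) -> P v) -> has_tree P (b ++ c) -> has_tree P b.
Proof.
elim: b P => [|e b IH] P clP /=.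
  by rewrite -[c]cats0 => /has_tree_cat[u _] /= /(clP [::]).
move=> [a0 [a1 [a01 h0 h1]]]; exists a0, a1.
by split => //; apply: IH => // v w; exact: (clP (_ :: v)).
Qed.

Lemma mkseq_cons (T : Type) (z : nat -> T) (n : nat) :
  mkseq z n.+1 = z 0%N :: mkseq (fun i => z i.+1) n.
Proof. by rewrite /mkseq /= (iotaDl 1 0) -map_comp. Qed.

(** A tree as a labelling of its nodes by the indices that lead to them: the
    branch of index [z] reads [f] along the nonempty prefixes of [z], and the
    condition on [f] at the branching levels makes branches split when their
    indices do.  This form is what a pointwise limit can be taken of. *)
Lemma has_tree_coding (A : finType) (a : A) (b : seq bool) (P : seq A -> Prop) :
  has_tree P b ->
  exists f : seq nat -> A,
    (forall z : nat -> nat,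
       (forall j, (j < size b)%N -> (z j <= nth false b j)%N) ->
       P (mkseq (fun i => f (mkseq z i.+1)) (size b))) /\
    (forall v : seq nat,
       nth false b (size v) -> f (rcons v 0%N) != f (rcons v 1%N)).
Proof.
elim: b P => [|e b IH] P.
  by move=> P0; exists (fun=> a); split => // v; rewrite nth_nil.
move=> [a0 [a1 [a01 /IH[f0 [Pf0 df0]] /IH[f1 [Pf1 df1]]]]].
pose f v := if v is x :: (_ :: _) as v' then
   if x == 0%N then f0 v' else f1 v' else
   if head 0%N v == 0%N then a0 else a1.
exists f; split.
  move=> z zb; rewrite /= mkseq_cons.
  have zb' j : (j < size b)%N -> (z j.+1 <= nth false b j)%N.
    exact: (zb j.+1).
  have -> : mkseq (fun i => f (mkseq z i.+2)) (size b) =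
     mkseq (fun i => (if z 0%N == 0%N then f0 else f1)
       (mkseq (fun i => z i.+1) i.+1)) (size b).
    by apply: eq_mkseq => i; rewrite mkseq_cons mkseq_cons /=; case: ifP.
  rewrite /f /=; case: eqP => _; [exact: Pf0|exact: Pf1].
case=> [|x [|y v]] //=; rewrite /f /=.
- by case: ifP => _ /=; [exact: (df0 [::])|exact: (df1 [::])].
- by case: ifP => _ /=; [exact: (df0 (y :: v))|exact: (df1 (y :: v))].
Qed.

Lemma sum_bool_tuples (k T n : nat) :
  (\sum_(b : n.-tuple bool) k ^ count id b * T ^ count negb b = (k + T) ^ n)%N.
Proof.
elim: n => [|n IH]; first by rewrite sum_tuple0 !expn0.
rewrite big_tuple_cons big_bool /= expnS -IH mulnDl !big_distrr /=.
by congr (_ + _)%N; apply: eq_bigr => b _; rewrite add0n add1n expnS;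
  rewrite ?mulnA // -!mulnA mulnCA.
Qed.

(** A Chernoff-style bound on the sum in [card_le_sum_trees]: as the structures
    that occur have |b| <= n / D, each weight #|A| ^ |b| T ^ n is at most
    T ^ (n / D) times #|A| ^ |b| T ^ (n - |b|), and the latter terms add up to
    (#|A| + T) ^ n.  The parameter T is to be chosen large. *)
Lemma card_le_sparse_trees (A : finType) (n D T : nat) (P : seq A -> Prop) :
  (0 < D)%N -> (0 < T)%N ->
  (forall b : n.-tuple bool, has_tree P b -> (D * count id b <= n)%N) ->
  (#|[set w : n.-tuple A | `[< P w >]]%SET| * T ^ n
   <= T ^ (n %/ D) * (#|A| + T) ^ n)%N.
Proof.
move=> D0 T0 sparse.
apply: leq_trans (leq_mul (card_le_sum_trees n P) (leqnn _)) _.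
rewrite -sum_bool_tuples big_distrl big_distrr /=; apply: leq_sum => b _.
case: asboolP => [/sparse tb|_]; last by rewrite mul0n.
have nE : (count id b + count negb b = n)%N.
  by rewrite (count_predC id) size_tuple.
rewrite mul1n; have -> : (T ^ n = T ^ count id b * T ^ count negb b)%N.
  by rewrite -expnD nE.
rewrite mulnCA leq_mul2r; apply/orP; right.
by rewrite leq_pexp2l // leq_divRL // mulnC.
Qed.

(** * Steady windows and approximate trees *)

(** If every position [p] between [N] and [size b - N] starts a block of length
    at most [N] and density below 1 / (2 D), jumping from block to block covers
    [b] up to its two ends, of length [N] each.  So [b] has at most
    size b / (2 D) + 2 N ones, too few when [size b > 4 D N]. *)
Lemma steady_window (D N : nat) (b : seq bool) :
  (0 < D)%N -> (4 * D * N < size b)%N -> (size b <= D * count id b)%N ->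
  exists b1 b2 b3, [/\ b = b1 ++ b2 ++ b3, (N <= size b1)%N, size b2 = N &
    forall i, (i <= N)%N -> (i <= 2 * D * count id (take i b2))%N].
Proof.
move=> D0 bN bD.
have [[p [Np pN H]]|nex] := pselect (exists p, [/\ (N <= p)%N,
  (p + N <= size b)%N &
  forall i, (i <= N)%N -> (i <= 2 * D * count id (take i (drop p b)))%N]).
  exists (take p b), (take N (drop p b)), (drop N (drop p b)).
  split.
  - by rewrite !cat_take_drop.
  - by rewrite size_take; case: ltnP => //; lia.
  - by rewrite size_take size_drop; case: ltnP => //; lia.
  - by move=> i iN; rewrite take_takel //; exact: H.
(* Otherwise every position starts a sparse block. *)
exfalso.
have poor p : (N <= p)%N -> (p + N <= size b)%N -> exists i, (0 < i <= N)%N &&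
    (2 * D * count id (take i (drop p b)) < i)%N.
  move=> Np pN; apply: contrapT => Hp; apply: nex; exists p; split => // i iN.
  by rewrite leqNgt; apply/negP => Hi; apply: Hp; exists i; rewrite Hi iN; lia.
have sparse m p : (size b - p <= m)%N -> (N <= p <= size b)%N ->
    (2 * D * count id (drop p b) <= (size b - p) + 2 * D * N)%N.
  elim: m p => [|m IH] p hm /andP[Np pb].
    have -> : p = size b by lia.
    by rewrite drop_size /= muln0.
  case: (leqP (p + N) (size b)) => pN; last first.
    have := count_size id (drop p b); rewrite size_drop => h.
    have : (2 * D * count id (drop p b) <= 2 * D * N)%N.
      by rewrite leq_mul2l; apply/orP; right; lia.
    lia.
  have [i /andP[/andP[i0 iN] hi]] := poor p Np pN.
  have := IH (p + i)%N.
  rewrite -[in count id (drop p b)](cat_take_drop i (drop p b)).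
  rewrite count_cat drop_drop (addnC i p) mulnDr => {}IH.
  have {}IH := IH ltac:(lia) ltac:(lia).
  move: hi IH; lia.
have := sparse (size b) N ltac:(lia) ltac:(nia).
have := count_size id (take N b).
rewrite -[in count id b](cat_take_drop N b) count_cat in bD.
rewrite size_take => h1 h2.
have h3 : (count id (take N b) <= N)%N by move: h1; case: ltnP; lia.
have h4 : (2 * D * count id (take N b) <= 2 * D * N)%N.
  by rewrite leq_mul2l h3 orbT.
move: bD h2 bN; rewrite mulnDr; nia.
Qed.

Lemma words_catl (A : finType) (X : set (configuration A)) (u v : seq A) :
  words X (u ++ v) -> words X u.
Proof.
move=> [x Xx]; rewrite size_cat /mkseq iotaD map_cat => /eqP.
by rewrite eqseq_cat ?size_map ?size_iota // => /andP[/eqP xu _]; exists x.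
Qed.

Lemma subshift_translate (A : finType) (X : set (configuration A)) (m : nat)
    (x : configuration A) :
  subshift X -> X x -> X (fun i : int => x (i + m%:Z)).
Proof.
move=> [_ shX] Xx; elim: m => [|m IH].
  by rewrite (_ : (fun _ => _) = x) //; apply/funext => i; rewrite addr0.
apply: shX; exists (fun i : int => x (i + m%:Z)) => //.
by apply/funext => i; rewrite /sigma -addrA -intS.
Qed.

Lemma words_catr (A : finType) (X : set (configuration A)) (u v : seq A) :
  subshift X -> words X (u ++ v) -> words X v.
Proof.
move=> shX [x Xx]; rewrite size_cat /mkseq iotaD map_cat => /eqP.
rewrite eqseq_cat ?size_map ?size_iota // => /andP[_ /eqP xv].
exists (fun i : int => x (i + (size u)%:Z)).
  exact: (subshift_translate _ shX Xx).
have iotaE : iota (0 + size u) (size v) = map (addn (size u)) (iota 0 (size v)).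
  by rewrite -iotaDl addn0.
by rewrite -[RHS]xv iotaE -map_comp; apply: eq_map => k /=; rewrite addrC.
Qed.

(** The infinite tree to be built, seen through the window of coordinates from
    [-N] to [N-1]: the past [x] and the branches of the tree only have to be
    visible in some point of [X] through this window. *)
Definition coded_in_window (A : finType) (X : set (configuration A)) (D N : nat)
    (x : nat -> A) (b : nat -> bool) (f : seq nat -> A) : Prop :=
  [/\ forall z : nat -> nat, (forall j, (j < N)%N -> (z j <= b j)%N) ->
        exists2 y, X y & forall k, (k < N)%N ->
          y (Posz k) = f (mkseq z k.+1) /\ y (Negz k) = x k,
      forall v, b (size v) -> f (rcons v 0%N) != f (rcons v 1%N) &
      forall i, (i <= N)%N -> (i <= D * \sum_(j < i) b j)%N].

(** A steady window of a long structure starts at a position at least [N]; the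
    [N] letters just before it on one branch serve as the past. *)
Lemma approximants (A : finType) (X : set (configuration A)) (D : nat) :
  subshift X -> (0 < D)%N ->
  (forall N, exists b, [/\ (N < size b)%N, (size b <= D * count id b)%N &
     has_tree (words X) b]) ->
  forall N, exists x b f, coded_in_window X (2 * D) N x b f.
Proof.
move=> shX D0 H N.
have [b [bN bD tb]] := H (4 * D * N)%N.
have [b1 [b2 [b3 [eb b1N b2N steady]]]] := steady_window D0 bN bD.
move: tb; rewrite eb => /has_tree_cat[u1 su1].
move=> /has_tree_take => /(_ (fun v w => _)) t2.
have {}t2 : has_tree (fun w => words X (u1 ++ w)) b2.
  by apply: t2 => v w; rewrite catA; exact: words_catl.
rewrite -[u1](cat_take_drop (size u1 - N)) in t2.
set u := drop (size u1 - N) u1 in t2.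
have su : size u = N by rewrite size_drop; lia.
have {}t2 : has_tree (fun w => words X (u ++ w)) b2.
  by apply: has_tree_mono t2 => w; rewrite -catA; exact: words_catr.
have [a _] : exists a : A, True.
  have := t2; rewrite -[b2]cats0 => /has_tree_cat[w _] [x _ _].
  by exists (x 0).
have [f [Pf df]] := has_tree_coding a t2.
exists (nth a (rev u)), (nth false b2), f; split => //.
  move=> z zb; rewrite -b2N in zb; have [x Xx] := Pf z zb.
  rewrite size_cat size_mkseq su b2N => xE.
  exists (fun i : int => x (i + N%:Z)).
    exact: (subshift_translate _ shX Xx).
  move=> k kN; split.
    rewrite -PoszD -(nth_mkseq a (fun k => x k%:Z) (n := N + N)) ?xE;
      last by lia.
    by rewrite nth_cat su ltnNge leq_addl /= addnK nth_mkseq.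
  rewrite nth_rev su // (_ : Negz k + N%:Z = (N - k.+1)%:Z); last by lia.
  rewrite -[LHS](nth_mkseq a (fun k => x k%:Z) (n := N + N)) ?xE;
      last by lia.
  by rewrite nth_cat su; case: ltnP => //; lia.
move=> i iN; apply: leq_trans (steady i iN) _.
rewrite leq_mul2l; apply/orP; right.
rewrite -sum1_count big_mkcond (big_nth false) size_take_min b2N.
rewrite (minn_idPl iN) big_mkord; apply: leq_sum => j _.
by rewrite nth_take //; case: (nth _ _ _).
Qed.

(** * Compactness *)

(** Sequences with values in a finite set converge along an ultrafilter.  One
    ultrafilter serves for all of them, hence for all coordinates of a past, a
    structure and a labelling at once. *)
Lemma finite_range_limit :
  exists G : set_system nat, [/\ ProperFilter G, \oo `<=` G &
    forall (T : finType) (g : nat -> T), exists t, \forall n \near G, g n = t].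
Proof.
have [G [GU ooG]] := ultraFilterLemma (@eventually_filter).
exists G; split => //; first exact: ultra_proper.
move=> T g; apply: contrapT => nex.
have GF : ProperFilter G := ultra_proper.
have : \forall n \near G, forall t, g n != t.
  apply: filter_forall => t.
  have [Gt|] := in_ultra_setVsetC [set n | g n = t] GU.
    by exfalso; apply: nex; exists t.
  by apply: filterS => n /= /eqP.
by move=> /filter_ex[n /(_ (g n))]; rewrite eqxx.
Qed.

Lemma closed_approx (A : finType) (X : set (configuration A))
    (x : configuration A) :
  closed X ->
  (forall N, exists2 y, X y & forall k, (k < N)%N ->
     y (Posz k) = x (Posz k) /\ y (Negz k) = x (Negz k)) -> X x.
Proof.
move=> clX H.
have /boolp.choice[y_ Hy] : forall N, exists y, X y /\ forall k, (k < N)%N ->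
     y (Posz k) = x (Posz k) /\ y (Negz k) = x (Negz k).
  by move=> N; have [y ? ?] := H N; exists y.
have yx : (y_ : nat -> configuration A) @ \oo --> x.
  apply/cvg_sup => i.
  rewrite cvg_image; last by rewrite eqEsubset; split=> v // _; exists (cst v).
  move=> W /= Wx.
  have {}Wx : W (x i) by exact: nbhs_singleton Wx.
  exists [set y : configuration A | W (y i)]; last first.
    rewrite eqEsubset; split => [_ [y ? <-] //|a Wa].
    by exists (fun=> a).
  exists `|i|.+1%N => // n /= ni; have [_ Hn] := Hy n.
  case: i Wx ni => k /= Wx ni.
    by have [-> _] := Hn k ni.
  by have [_ ->] := Hn k ltac:(lia).
apply: (closed_cvg _ clX _ _ yx).
by apply: nearW => n; have [] := Hy n.
Qed.

(** The condition on the branch [z] up to coordinate [N] involves finitely many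
    values of the past, of the structure and of the labelling, so it passes to
    the limit along the ultrafilter. *)
Lemma exists_tree_coding (A : finType) (X : set (configuration A)) (D : nat) :
  closed X ->
  (forall N, exists x b f, coded_in_window X D N x b f) ->
  exists (x : nat -> A) (b : nat -> bool) (f : seq nat -> A),
    [/\ forall z : nat -> nat, seq_le z b ->
          X (concat x (fun k => f (mkseq z k.+1))),
        forall v, b (size v) -> f (rcons v 0%N) != f (rcons v 1%N) &
        forall i, (i <= D * \sum_(j < i) b j)%N].
Proof.
move=> clX /boolp.choice[x_ /boolp.choice[b_ /boolp.choice[f_ H]]].
have [G [GF ooG lim]] := finite_range_limit.
have [x Hx] := boolp.choice (fun k => lim _ (fun n => x_ n k)).
have [b Hb] := boolp.choice (fun k => lim _ (fun n => b_ n k)).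
have [f Hf] := boolp.choice (fun v => lim _ (fun n => f_ n v)).
have near_lt (N : nat) (Q : nat -> nat -> Prop) :
    (forall k, \forall n \near G, Q n k) ->
    \forall n \near G, forall k, (k < N)%N -> Q n k.
  move=> GQ; have : \forall n \near G, forall k : 'I_N, Q n k.
    by apply: filter_forall => k.
  by apply: filterS => n Qn k kN; exact: (Qn (Ordinal kN)).
have Ginter (P Q : nat -> Prop) : (\forall n \near G, P n) ->
    (\forall n \near G, Q n) -> \forall n \near G, P n /\ Q n.
  exact: filterI.
exists x, b, f; split.
- move=> z zb; apply: closed_approx => // N.
  have : \forall n \near G, (N <= n)%N by apply: ooG; exists N.
  have := near_lt N _ Hx; have := near_lt N _ Hb.
  have := near_lt N _ (fun k => Hf (mkseq z k.+1)).
  move=> Gf Gb Gx GN.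
  have /filter_ex[n [[[nf nb] nx] nN]] :=
    Ginter _ _ (Ginter _ _ (Ginter _ _ Gf Gb) Gx) GN.
  have [Hn _ _] := H n.
  (* The index z is only known to satisfy z <= b_n below N; truncating it
     there keeps the part of the branch inside the window. *)
  pose z' j := if (j < N)%N then z j else 0%N.
  have [|y Xy yE] := Hn z'.
    by move=> j _; rewrite /z'; case: ifP => // jN; rewrite nb.
  exists y => // k kN; have [-> ->] := yE k (leq_trans kN nN).
  rewrite /= -nf // nx //; split => //; congr (f_ n _).
  apply/eq_in_map => j; rewrite mem_iota => /andP[_ jk].
  by rewrite /z' ifT //; lia.
- move=> v bv; have /filter_ex[n [[nb n0] n1]] :=
    Ginter _ _ (Ginter _ _ (Hb (size v)) (Hf (rcons v 0%N))) (Hf (rcons v 1%N)).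
  have [_ Hn _] := H n; rewrite /= in nb n0 n1; rewrite -n0 -n1; apply: Hn.
  by rewrite nb.
- move=> i; have : \forall n \near G, (i <= n)%N by apply: ooG; exists i.
  move=> /(Ginter _ _ (near_lt i _ Hb)) /filter_ex[n [nb ni]].
  have [_ _ Hn] := H n; apply: leq_trans (Hn i ni) _.
  by apply/eq_leq; congr (_ * _)%N; apply: eq_bigr => j _; rewrite nb.
Qed.

(** Where two indices first differ, the level must branch and the indices are 0
    and 1 there, so the condition on [f] separates the two branches. *)
Lemma tree_of_coding (A : finType) (S : set (nat -> A)) (b : nat -> bool)
    (f : seq nat -> A) :
  (forall z : nat -> nat, seq_le z b -> S (fun k => f (mkseq z k.+1))) ->
  (forall v, b (size v) -> f (rcons v 0%N) != f (rcons v 1%N)) ->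
  tree_in S b (fun z k => f (mkseq z k.+1)).
Proof.
move=> Sf df; split => // z z' zb z'b i; split; last first.
  move=> zz' j ji; congr (f _); apply/eq_in_map => k.
  by rewrite mem_iota => /andP[_ kj]; apply: zz'; lia.
elim: i => [|i IH] // xx'.
have {}IH : agree_below i z z' by apply: IH => j ji; apply: xx'; lia.
move=> j; rewrite ltnS leq_eqVlt => /orP[/eqP {j}->|]; last exact: IH.
have := xx' i (leqnn _); rewrite !mkseqS.
have -> : mkseq z i = mkseq z' i.
  by apply/eq_in_map => k; rewrite mem_iota => /andP[_]; exact: IH.
have := zb i; have := z'b i; case: (boolP (b i)) => [bi|_]; last by lia.
have := df (mkseq z' i); rewrite size_mkseq => /(_ bi) /eqP.
by case: (z i) => [|[|?]]; case: (z' i) => [|[|?]] // d _ _ e; case: d;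
  rewrite e.
Qed.

(** * Existence of the entropy *)

(** Fekete's lemma.  The limit is the infimum of the quotients: if u_m / m is
    within e / 2 of it, then u_n <= (n / m) u_m + C by division of n by m, the
    remainders contributing at most C = m u_1 + u_0. *)
Lemma fekete (R : realType) (u : nat -> R) :
  (forall n, 0 <= u n) -> (forall m n, u (m + n)%N <= u m + u n) ->
  cvgn (fun n => u n / n%:R).
Proof.
move=> u0 uD.
have u_mul m q r : u (q * m + r)%N <= q%:R * u m + u r.
  elim: q => [|q IH]; first by rewrite mul0n mul0r add0r.
  rewrite mulSn -addnA; apply: le_trans (uD _ _) _.
  by rewrite -natr1 mulrDl mul1r; lra.
pose E := [set u n.+1 / n.+1%:R | n in [set: nat]].
have E_lb : has_lbound E by exists 0 => _ [n _ <-]; exact: divr_ge0.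
have E_inf : has_inf E by split => //; exists (u 1%N / 1); exists 0%N.
apply/cvg_ex; exists (inf E); apply/cvgrPdist_le => e e0.
have e2 : 0 < e / 2 by lra.
have [_ [m _ <-] hm] := inf_adherent e2 E_inf.
set d := u m.+1 / m.+1%:R in hm.
pose C := m.+1%:R * u 1%N + u 0%N.
near=> n.
have n0 : 0 < n%:R :> R by near: n; exact: nbhs_infty_gtr.
have Cn : C / n%:R <= e / 2.
  rewrite ler_pdivrMr // -ler_pdivrMl //; apply: ltW.
  by near: n; exact: nbhs_infty_gtr.
have lb : inf E <= u n / n%:R.
  by apply: ge_inf => //; exists n.-1 => //; rewrite prednK // -(ltr0n R).
have ur : u (n %% m.+1)%N <= C.
  have := u_mul 1%N (n %% m.+1)%N 0%N; rewrite muln1 addn0 => h.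
  apply: le_trans h _; rewrite lerD2r ler_wpM2r // ler_nat ltnW //.
  exact: ltn_pmod.
have un : u n <= n%:R * d + C.
  rewrite [in u n](divn_eq n m.+1); apply: le_trans (u_mul _ _ _) _.
  rewrite lerD // /d [leRHS]mulrCA [leLHS]mulrC ler_wpM2l //.
  rewrite ler_pdivlMr ?ltr0n // -natrM ler_nat; exact: leq_trunc_div.
have ub : u n / n%:R <= d + C / n%:R.
  by rewrite ler_pdivrMr // mulrDl divfK ?gt_eqF // mulrC.
rewrite ler_distlC; lra.
Unshelve. all: by end_near.
Qed.

Lemma ln_nat_ge0 (R : realType) (n : nat) : 0 <= ln (n%:R : R).
Proof.
by case: n => [|n]; [rewrite ln0|rewrite ln_ge0 // ler1n].
Qed.

Lemma ler_ln_nat (R : realType) (m n : nat) :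
  (m <= n)%N -> ln (m%:R : R) <= ln n%:R.
Proof.
case: m => [|m] mn; first by rewrite ln0 // ln_nat_ge0.
by rewrite ler_ln ?ler_nat // posrE ltr0n // (leq_trans _ mn).
Qed.

Lemma card_words_submul (A : finType) (X : set (configuration A)) (m n : nat) :
  subshift X ->
  (#|words_of_length X (m + n)|
   <= #|words_of_length X m| * #|words_of_length X n|)%N.
Proof.
move=> shX; rewrite -cardsX.
pose f (p : m.-tuple A * n.-tuple A) := [tuple of p.1 ++ p.2].
apply: leq_trans (leq_imset_card f _); apply: subset_leq_card.
apply/fintype.subsetP => w; rewrite inE => /asboolP Xw.
have su : size (take m w) == m by rewrite size_takel // size_tuple leq_addr.
have sv : size (drop m w) == n by rewrite size_drop size_tuple addKn.
rewrite -(cat_take_drop m w) in Xw.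
apply/imsetP; exists (Tuple su, Tuple sv).
  by rewrite !inE /=; apply/andP; split; apply/asboolP;
    [exact: words_catl Xw|exact: words_catr Xw].
by apply: val_inj; rewrite /= cat_take_drop.
Qed.

Lemma is_cvg_entropy (R : realType) (A : finType) (X : set (configuration A)) :
  subshift X ->
  cvgn (fun n : nat => ln (#|words_of_length X n|%:R : R) / n%:R).
Proof.
move=> shX; apply: (@fekete R (fun n => ln (#|words_of_length X n|%:R : R))).
  by move=> n; exact: ln_nat_ge0.
move=> m n; apply: le_trans (ler_ln_nat R (card_words_submul m n shX)) _.
have [->|a0] := posnP #|words_of_length X m|.
  by rewrite mul0n [ln 0%:R]ln0 // add0r ln_nat_ge0.
have [->|b0] := posnP #|words_of_length X n|.
  by rewrite muln0 [ln 0%:R]ln0 // addr0 ln_nat_ge0.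
by rewrite natrM lnM // posrE ltr0n.
Qed.

(** * From entropy to trees and back *)

(** If all structures of length n with a tree in the language satisfied
    D |b| <= n, then [card_le_sparse_trees] would give
    ln |L_n| <= n (ln (1 + #|A| / T) + ln T / D), with
    ln (1 + #|A| / T) <= #|A| / T.  With h the entropy, T is chosen to bring
    #|A| / T below h / 8, then D to bring ln T / D below h / 8, whereas ln |L_n|
    is at least n h / 2 for n large. *)
Lemma has_long_tree (R : realType) (A : finType) (X : set (configuration A)) :
  subshift X -> 0 < entropy R X ->
  exists2 D, (0 < D)%N & forall N, exists b,
    [/\ (N < size b)%N, (size b <= D * count id b)%N & has_tree (words X) b].
Proof.
move=> shX; set h := entropy R X => h0.
pose c := h / 2; have c0 : 0 < c by rewrite /c; lra.
have [N0 _ HN0] : \forall n \near \oo,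
    c <= ln (#|words_of_length X n|%:R : R) / n%:R.
  have cvgh :
      (fun n : nat => ln (#|words_of_length X n|%:R : R) / n%:R) @ \oo --> h.
    exact: is_cvg_entropy.
  by apply: (cvgr_ge _ cvgh); rewrite /c; lra.
pose k := #|A|.
pose T := (Num.trunc (4 * k%:R / c)).+1.
have kT : k%:R / T%:R <= c / 4.
  rewrite ler_pdivrMr ?ltr0n // -ler_pdivrMl; last by lra.
  rewrite (_ : _ * _ = 4 * k%:R / c); first exact/ltW/truncnS_gt.
  by field; rewrite gt_eqF.
pose D := (Num.trunc (4 * ln (T%:R : R) / c)).+1.
have TD : ln T%:R <= D%:R * (c / 4) :> R.
  rewrite -ler_pdivrMr; last by lra.
  rewrite (_ : _ / _ = 4 * ln T%:R / c); first exact/ltW/truncnS_gt.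
  by field; rewrite gt_eqF.
exists D => // N; apply: contrapT => nex.
pose n := (maxn N N0).+1.
have Nn : (N < n)%N by rewrite ltnS leq_maxl.
have /HN0 hn : (N0 <= n)%N by rewrite /n -addn1 ltnW // addn1 ltnS leq_maxr.
have n0 : 0 < n%:R :> R by rewrite ltr0n.
rewrite /= ler_pdivlMr // in hn.
have := @card_le_sparse_trees A n D T (words X) isT isT.
set L := #|_| => HL.
have {}HL : (L * T ^ n <= T ^ (n %/ D) * (k + T) ^ n)%N.
  apply: HL => b tb; rewrite leqNgt; apply/negP => bD; apply: nex.
  by exists b; rewrite size_tuple; split => //; exact: ltnW.
rewrite -/L in hn.
have L0 : (0 < L)%N.
  rewrite lt0n; apply/eqP => L0; rewrite L0 ln0 // in hn.
  by have := mulr_gt0 c0 n0; lra.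
have T0 : (0 < T)%N by [].
have := ler_ln_nat R HL.
rewrite !natrM !natrX !lnM ?posrE ?exprn_gt0 ?ltr0n ?addn_gt0 ?T0 ?orbT //.
rewrite !lnXn ?ltr0n ?addn_gt0 ?T0 ?orbT // -!(mulr_natr (ln _)).
have -> : (k + T)%:R = T%:R * (1 + k%:R / T%:R) :> R.
  by rewrite natrD mulrDr mulr1 mulrCA divff ?mulr1 1?addrC // pnatr_eq0.
have k0 : 0 <= k%:R / T%:R :> R by exact: divr_ge0.
rewrite lnM ?posrE ?ltr0n //.
have lk : ln (1 + k%:R / T%:R) <= c / 4 :> R.
  by apply: le_trans (le_ln1Dx (lt_le_trans _ k0)) kT; rewrite ltrN10.
have lT : ln T%:R * (n %/ D)%:R <= n%:R * (c / 4) :> R.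
  apply: le_trans (ler_wpM2r _ TD) _ => //.
  rewrite mulrAC -natrM ler_wpM2r ?ler_nat //; first by lra.
  by rewrite mulnC leq_trunc_div.
have lk' := ler_wpM2r (ltW n0) lk.
have := mulr_gt0 c0 n0.
rewrite mulrDl; lra.
Qed.

(** Distinct prefixes of indices give distinct prefixes of branches, and the
    prefixes of length n of indices z <= b form a product of n sets, of sizes
    b_j + 1 = 2 ^ b_j. *)
Lemma card_prefixes (A : finType) (X : set (configuration A)) (x : nat -> A)
    (b : nat -> nat) (y : (nat -> nat) -> nat -> A) (n : nat) :
  (forall i, (b i <= 1)%N) -> tree_in [set y | X (concat x y)] b y ->
  (2 ^ (\sum_(0 <= j < n) b j) <= #|words_of_length X n|)%N.
Proof.
move=> b1 [Xy yE].
pose F (j : 'I_n) := [pred c : bool | (c <= b j)%N].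
pose z (f : {ffun 'I_n -> bool}) (j : nat) : nat :=
  if insub j is Some i then f i else 0%N.
have zE f (j : 'I_n) : z f j = f j by rewrite /z valK.
have zb f : f \in family F -> seq_le (z f) b.
  by move=> /familyP fF j; rewrite /z; case: insubP => // i _ <-; exact: fF.
have <- : #|family F| = (2 ^ \sum_(0 <= j < n) b j)%N.
  rewrite card_family foldrE big_map big_enum /= big_mkord expn_sum.
  apply: eq_bigr => j _; have := b1 j.
  rewrite -sum1_card big_mkcond big_bool /=.
  by case: (b j) => [|[|]].
pose g f := [tuple y (z f) j | j < n].
have g_inj : {in family F &, injective g}.
  move=> f f' fF f'F gE; apply/ffunP => i.
  suff : z f i = z f' i by rewrite !zE; case: (f i); case: (f' i).
  have /(yE _ _ (zb _ fF) (zb _ f'F)) : agree_below n (y (z f)) (y (z f')).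
    move=> j jn; have /(congr1 (fun t => tnth t (Ordinal jn))) := gE.
    by rewrite !tnth_mktuple.
  exact.
rewrite -(card_in_imset g_inj); apply: subset_leq_card.
apply/fintype.subsetP => _ /imsetP[f fF ->]; rewrite inE; apply/asboolP.
exists (concat x (y (z f))); first exact: Xy (zb f fF).
rewrite size_tuple /= /mkseq -[iota 0 n]val_enum_ord -map_comp.
by apply: eq_map => j.
Qed.

(** The lower limit of the averages is the supremum of the infima of their
    tails, so it is positive exactly when some tail is bounded away from 0. *)
Lemma steadily_branchingP (R : realType) (b : nat -> nat) :
  (forall i, (b i <= 1)%N) ->
  steadily_branching R b <->
  exists2 e : R, 0 < e &
    exists N, forall n, (N <= n)%N -> e * n%:R <= (\sum_(0 <= j < n) b j)%:R.
Proof.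
move=> b1.
pose avg (i : nat) : R := (\sum_(0 <= j < i) (b j)%:R) / i%:R.
have avg_le1 i : avg i <= 1.
  rewrite /avg -natr_sum; case: (posnP i) => [->|i0].
    by rewrite invr0 mulr0.
  rewrite ler_pdivrMr ?ltr0n // mul1r ler_nat.
  apply: (@leq_trans (\sum_(0 <= j < i) 1)%N); first exact: leq_sum.
  by rewrite sum_nat_const_nat subn0 muln1.
have avg_lb : has_lbound (range avg).
  by exists 0 => _ [i _ <-]; apply: divr_ge0 => //; exact: sumr_ge0.
have limn_inf_avg : limn_inf avg = sup (range (infs avg)).
  by apply/cvg_lim => //; apply: cvg_infs_sup => //; exists 1 => _ [i _ <-].
have avgE n e : (0 < n)%N ->
    (e <= avg n) = (e * n%:R <= (\sum_(0 <= j < n) b j)%:R).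
  by move=> n0; rewrite /avg ler_pdivlMr ?ltr0n // natr_sum.
split.
- move=> [_]; rewrite -/avg limn_inf_avg => /sup_gt[|_ [N _ <-] e0].
    by exists (infs avg 0); exists 0%N.
  exists (infs avg N) => //; exists N => -[|n] nN.
    by rewrite mulr0 ler0n.
  rewrite -avgE //; apply: ge_inf; last by exists n.+1.
  exact: has_lbound_sdrop.
- move=> [e e0 [N HN]]; split => //; rewrite -/avg limn_inf_avg.
  apply: (@lt_le_trans _ _ (infs avg N.+1)); last first.
    apply: ub_le_sup; last by exists N.+1.
    exists 1 => _ [n _ <-]; apply: le_trans (avg_le1 n).
    by apply: ge_inf; [exact: has_lbound_sdrop|exists n => /=].
  apply: lt_le_trans e0 _; apply: lb_le_inf.
    by exists (avg N.+1), N.+1 => /=.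
  by move=> _ [n /= Nn <-]; rewrite avgE ?HN //; lia.
Qed.

Theorem theorem2 (R : realType) (A : finType) (X : set (configuration A)) :
  subshift X ->
  (0 < entropy R X <->
   exists x : nat -> A,
     contains_steadily_branching_binary_tree R
       [set y : nat -> A | X (concat x y)]).
Proof.
move=> shX; split.
- move=> /(has_long_tree shX)[D D0 Hb].
  have [x [b [f [Xf df steady]]]] :=
    exists_tree_coding shX.1 (approximants shX D0 Hb).
  exists x, b, (fun z k => f (mkseq z k.+1)); split; last exact: tree_of_coding.
  apply/steadily_branchingP; first by move=> i; case: (b i).
  exists ((2 * D)%:R^-1); first by rewrite invr_gt0 ltr0n; lia.
  exists 0%N => n _; rewrite mulrC ler_pdivrMr ?ltr0n; last by lia.
  by rewrite -natrM ler_nat mulnC big_mkord; exact: steady.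
- move=> [x [b [y [sb tree]]]]; have [b1 _] := sb.
  have [e e0 [N HN]] := (steadily_branchingP R b1).1 sb.
  have ln2 : 0 < ln 2 :> R by rewrite ln_gt0 // ltr1n.
  apply: (@lt_le_trans _ _ (e * ln 2)); first exact: mulr_gt0.
  apply: limr_ge; first exact: is_cvg_entropy.
  exists N.+1 => // n /= Nn.
  rewrite ler_pdivlMr ?ltr0n; last by lia.
  apply: le_trans (ler_ln_nat R (card_prefixes n b1 tree)).
  rewrite natrX lnXn // -(mulr_natl (ln _)) mulrAC ler_wpM2r ?(ltW ln2) //.
  by apply: HN; lia.
Qed.
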